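(* Let $L$ be a distributive weakly dicomplemented lattice such that $\Phi=\Delta_L$, where $\Phi=\{(x,y)\in L^{2}\mid x^{\nabla}=y^{\nabla}\text{ and }x^{\Delta}=y^{\Delta}\}$. Then: (1) $L$ is subdirectly irreducible if and only if $NF(L)$ has a unique atom. (2) $L$ is simple if and only if $\mathrm{Card}(NF(L))=2$.
   Context: A weakly dicomplemented lattice (WDL) is an algebra $(L;\wedge,\vee,{}^{\Delta},{}^{\nabla},0,1)$ of type $(2,2,1,1,0,0)$ such that $(L;\wedge,\vee,0,1)$ is a bounded lattice and for all $x,y\in L$: $x^{\Delta\Delta}\le x$; $x\le y\Rightarrow y^{\Delta}\le x^{\Delta}$; $(x\wedge y)\vee(x\wedge y^{\Delta})=x$; $x^{\nabla\nabla}\ge x$; $x\le y\Rightarrow y^{\nabla}\le x^{\nabla}$; $(x\vee y)\wedge(x\vee y^{\nabla})=x$. It is distributive if its underlying lattice is. All algebras are assumed to have at least two elements. $\Delta_L=\{(x,x)\mid x\in L\}$ and $\mathrm{Con}(L)$ is the set of congruences (equivalence relations compatible with $\wedge,\vee,{}^{\Delta},{}^{\nabla}$). $L$ is simple if $\mathrm{Con}(L)=\{\Delta_L,L^2\}$, and subdirectly irreducible if $\mathrm{Con}(L)\setminus\{\Delta_L\}$ has a least element. A filter is a nonempty upward closed subset closed under $\wedge$ ($L$ itself is allowed); a filter $F$ is normal if $x\in F$ implies $(x^{\Delta})^{\nabla}\in F$. $NF(L)$ is the lattice of normal filters ordered by inclusion; its least element is $\{1\}$.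
   Formalization: In (1), ''NF(L) has a unique atom'' is taken to mean that NF(L) has exactly one atom and this atom lies below every normal filter other than {1}; with only ''exactly one atom'' the converse fails, e.g. for 2 × B with B an atomless Boolean algebra. *)

(* Defs.v *)
From HB Require Import structures.
From mathcomp Require Import all_boot all_order.
From mathcomp Require Import mathcomp_extra boolp classical_sets functions cardinality.

Set Implicit Arguments.
Unset Strict Implicit.
Unset Printing Implicit Defensive.

(* MathComp world, with the classical sets of MathComp-Analysis.
   [tri x] is x^Δ (dual weak complementation) and [nab x] is x^∇ (weak
   complementation). *)
HB.mixin Record isWeaklyDicomplemented d L of Order.TBLattice d L := {
  tri : L -> L;
  nab : L -> L;
  tri_tri_le : forall x : L, (tri (tri x) <= x)%O;
  tri_antitone : forall x y : L, (x <= y)%O -> (tri y <= tri x)%O;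
  meet_join_tri : forall x y : L, ((x `&` y) `|` (x `&` tri y) = x)%O;
  le_nab_nab : forall x : L, (x <= nab (nab x))%O;
  nab_antitone : forall x y : L, (x <= y)%O -> (nab y <= nab x)%O;
  join_meet_nab : forall x y : L, ((x `|` y) `&` (x `|` nab y) = x)%O
}.

#[short(type="wdlType")]
HB.structure Definition WDL d :=
  { L of isWeaklyDicomplemented d L & Order.TBLattice d L }.

#[short(type="distrWdlType")]
HB.structure Definition DistrWDL d :=
  { L of WDL d L & Order.TBDistrLattice d L }.

Local Open Scope classical_set_scope.

(* Families of subsets are ordered by inclusion. *)
Definition is_least {T : Type} (C : set (set T)) (A : set T) : Prop :=
  C A /\ forall B, C B -> A `<=` B.

(* [bot] is meant to be the least element of the family C. *)
Definition is_atom {T : Type} (C : set (set T)) (bot A : set T) : Prop :=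
  [/\ C A, A <> bot & forall B, C B -> B `<=` A -> B = bot \/ B = A].

(* "C has a unique atom" is meant here in the sense customary for
   characterizing subdirect irreducibility: C has exactly one atom, and that
   atom lies below every member of C other than [bot]. The second clause is not
   redundant, since C need not be atomic: the filters of the Boolean algebra
   2 x B with B atomless have exactly one atom, yet 2 x B is not subdirectly
   irreducible. *)
Definition has_unique_atom {T : Type} (C : set (set T)) (bot : set T) : Prop :=
  exists A, unique (is_atom C bot) A /\
            (forall B, C B -> B <> bot -> A `<=` B).

Section WeaklyDicomplemented.
Context {d : Order.disp_t} (L : wdlType d).

Definition is_congruence (t : set (L * L)) : Prop :=
  [/\ (forall x, t (x, x)),
      (forall x y, t (x, y) -> t (y, x)) &
      (forall x y z, t (x, y) -> t (y, z) -> t (x, z))] /\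
  [/\ (forall x x' y y', t (x, x') -> t (y, y') ->
         t ((x `&` y)%O, (x' `&` y')%O)),
      (forall x x' y y', t (x, x') -> t (y, y') ->
         t ((x `|` y)%O, (x' `|` y')%O)),
      (forall x y, t (x, y) -> t (tri x, tri y)) &
      (forall x y, t (x, y) -> t (nab x, nab y))].

Definition Con : set (set (L * L)) := [set t | is_congruence t].

Definition Delta : set (L * L) := [set p | p.1 = p.2].

Definition Phi : set (L * L) :=
  [set p | nab p.1 = nab p.2 /\ tri p.1 = tri p.2].

Definition simple : Prop := Con = [set Delta; [set: L * L]].

Definition subdirectly_irreducible : Prop :=
  exists mu, is_least (Con `\ Delta) mu.

Definition is_filter (F : set L) : Prop :=
  [/\ F !=set0,
      (forall x y, F x -> (x <= y)%O -> F y) &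
      (forall x y, F x -> F y -> F (x `&` y)%O)].

Definition is_normal_filter (F : set L) : Prop :=
  is_filter F /\ forall x, F x -> F (nab (tri x)).

Definition NF : set (set L) := [set F | is_normal_filter F].

End WeaklyDicomplemented.

Arguments Con {d} L _.
Arguments Delta {d} L _.
Arguments Phi {d} L _.
Arguments NF {d} L _.

(* Main.v *)
Require Import Defs.
From mathcomp Require Import all_boot all_order.
From mathcomp Require Import mathcomp_extra boolp classical_sets functions cardinality.

Local Open Scope classical_set_scope.
Local Open Scope card_scope.

Import Order.TTheory.

(** Normal filters and congruences are linked by two monotone maps: a normal
    filter [F] gives the congruence [filter_congr F], which identifies [x] and
    [y] when [x `&` f = y `&` f] for some [f] in [F], and a congruence [t] gives
    the class of the top element, [top_class t]. In general,
    [top_class (filter_congr F) = F] and [filter_congr (top_class t)] is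
    contained in [t]. Both parts of the theorem follow at once if, in addition,
    a congruence other than the diagonal has a top class other than the
    singleton of the top element ([top_class_neq1]): then the least nontrivial
    congruence and the least nontrivial normal filter correspond to each other,
    and there are only the two trivial congruences exactly when there are only
    the two trivial normal filters.

    The substance is therefore [separated_congr_trivial]: if Phi is trivial,
    then a congruence [t] whose top class is a singleton is the diagonal.
    Triviality of Phi lets two elements be identified by comparing their images
    under [nab] and [tri]. For related elements [a <= u], a meet with [tri u]
    makes both [tri] equal to the top element, so the only thing to prove is
    [nab a <= nab u].

    That inequality ([nab_le_related]) is obtained from [related_exchange], in
    which Phi is used a first time: out of related elements one builds a pair
    [v2 <= u2] on which both [nab] and [tri] agree by construction, and the
    resulting equality [v2 = u2] gives a new inequality between the initial
    elements. It is applied three times: the first two applications supply the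
    hypotheses of the third, from which [u <= nab (nab a)], that is,
    [nab a <= nab u]. *)

(** * Arithmetic of the two weak complementations *)

Section WDLArithmetic.
Context {d : Order.disp_t} {L : wdlType d}.
Local Open Scope order_scope.
Implicit Types x y : L.

Lemma join_tri x : x `|` tri x = \top.
Proof. by have := meet_join_tri \top x; rewrite !meet1x. Qed.

Lemma meet_nab x : x `&` nab x = \bot.
Proof. by have := join_meet_nab \bot x; rewrite !join0x. Qed.

Lemma tri1 : tri (\top : L) = \bot.
Proof.
have t0 : tri \bot = \top :> L by have := join_tri \bot; rewrite join0x.
by apply/eqP; rewrite -lex0 -t0 tri_tri_le.
Qed.

Lemma nab1 : nab (\top : L) = \bot.
Proof. by have := meet_nab \top; rewrite meet1x. Qed.

Lemma nab0 : nab (\bot : L) = \top.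
Proof. by apply/eqP; rewrite -le1x -nab1 le_nab_nab. Qed.

Lemma nabU x y : nab (x `|` y) = nab x `&` nab y.
Proof.
apply/le_anti; rewrite lexI !nab_antitone ?leUl ?leUr //=.
apply: le_trans (le_nab_nab _) _; apply: nab_antitone.
by rewrite leUx; apply/andP; split; apply: le_trans (le_nab_nab _) _;
  apply: nab_antitone; rewrite ?leIl ?leIr.
Qed.

Lemma triI x y : tri (x `&` y) = tri x `|` tri y.
Proof.
apply/le_anti; rewrite leUx !tri_antitone ?leIl ?leIr //= andbT.
apply: le_trans (tri_tri_le _); apply: tri_antitone.
by rewrite lexI; apply/andP; split; apply: le_trans (tri_tri_le _);
  apply: tri_antitone; rewrite ?leUl ?leUr.
Qed.

End WDLArithmetic.

(** * Congruences with a trivial top class *)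

Section SeparatedCongruence.
Context {d : Order.disp_t} {L : distrWdlType d}.
Local Open Scope order_scope.
Implicit Types a b o u x y z : L.

(** [lattice] proves an inequality between distributive lattice terms by
    distributing the left side into a join of meets and the right side into a
    meet of joins, then searching for a common member in each elementary
    inequality. *)
Ltac lattice_leaf := first [ exact: lexx | exact: le0x | exact: lex1
  | apply: leIxl; lattice_leaf | apply: leIxr; lattice_leaf
  | apply: lexUl; lattice_leaf | apply: lexUr; lattice_leaf ].
Ltac lattice :=
  rewrite ?[in leLHS](meetUl, meetUr) ?[in leRHS](joinIl, joinIr) ?leUx ?lexI;
  repeat (apply/andP; split); lattice_leaf.

Lemma le_cut x y z : x <= y `|` z -> x `&` z <= y -> x <= y.
Proof.
move=> xyz xzy; rewrite -(meet_idPl xyz) meetUr leUx xzy andbT.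
by rewrite leIr.
Qed.

Lemma le_cut_bot x y z : x <= y `|` z -> x `&` z = \bot -> x <= y.
Proof. by move=> /le_cut + xz0; rewrite xz0; apply; rewrite le0x. Qed.

Context (t : set (L * L)) (t_congr : is_congruence t).
Context (t_top : forall x, t (x, \top) -> x = \top).
Context (Phi_trivial : forall x y, nab x = nab y -> tri x = tri y -> x = y).

Let t_refl x : t (x, x). Proof. by case: t_congr => [[]]. Qed.
Let t_sym x y : t (x, y) -> t (y, x).
Proof. by case: t_congr => [[_ + _] _]; apply. Qed.
Let t_trans y x z : t (x, y) -> t (y, z) -> t (x, z).
Proof. by case: t_congr => [[_ _ +] _]; apply. Qed.
Let tI x x' y y' : t (x, x') -> t (y, y') -> t (x `&` y, x' `&` y').
Proof. by case: t_congr => [_ [+ _ _ _]]; apply. Qed.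
Let tU x x' y y' : t (x, x') -> t (y, y') -> t (x `|` y, x' `|` y').
Proof. by case: t_congr => [_ [_ + _ _]]; apply. Qed.
Let t_tri x y : t (x, y) -> t (tri x, tri y).
Proof. by case: t_congr => [_ [_ _ + _]]; apply. Qed.
Let t_nab x y : t (x, y) -> t (nab x, nab y).
Proof. by case: t_congr => [_ [_ _ _ +]]; apply. Qed.

(** The class of the bottom element is a singleton too, because [nab] sends
    it into the class of the top element. *)
Lemma related_bot x : t (x, \bot) -> x = \bot.
Proof.
move=> /t_nab; rewrite nab0 => /t_top x1.
by apply/eqP; rewrite -lex0 (le_trans (le_nab_nab x)) // x1 nab1.
Qed.

(** If [u] is related to [u `&` b], then [u `&` o] ought to lie below [b] up to
    [t]; the point is to turn this into an actual inequality, with an error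
    term [x] that is controlled by [tri] only. The related elements
    [v1 <= u1 = v1 `|` (u `&` o)] are chosen so that [u1 <= v1] yields the
    claim. Since [v1 `|` tri u1] is related to the top element, it is the top
    element, so [v1] and [u1] can be compared after a meet with [tri u1 `|` b].
    The third hypothesis makes [nab] of the two meets agree, the fourth one makes
    [tri] agree, and then Phi identifies them. *)
Lemma related_exchange b o u x :
    b <= o -> t (u, u `&` b) ->
    nab b <= nab u `|` o -> tri x `&` b <= tri o ->
  u `&` o <= b `|` x.
Proof.
move=> bo tub nb xb.
have [q qE] : {q | q = nab b} by exists (nab b).
have [p pE] : {p | p = q `&` nab u} by exists (q `&` nab u).
have [v1 v1E] : {v1 | v1 = b `|` (u `&` o `&` x) `|` (q `&` o)} by eexists.
have [u1 u1E'] : {u1 | u1 = v1 `|` (u `&` o)} by eexists.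
have [g gE] : {g | g = tri u1} by exists (tri u1).
have [v2 v2E] : {v2 | v2 = v1 `&` (g `|` b)} by eexists.
have [u2 u2E] : {u2 | u2 = u1 `&` (g `|` b)} by eexists.
have bq0 : b `&` q = \bot by rewrite qE meet_nab.
have uq0 : u `&` q = \bot.
  apply: related_bot; rewrite -[X in t (_, X)](meetx0 u) -bq0 meetA.
  by apply: tI.
have u1E : u1 = b `|` (u `&` o) `|` (q `&` o).
  by apply/le_anti/andP; split; rewrite u1E' v1E; lattice.
have tv1u1 : t (v1, u1).
  rewrite u1E' -[X in t (X, _)](@join_l _ _ v1 (u `&` b `&` o)).
    by apply/tU/tI => //; apply: t_sym.
  by rewrite v1E; lattice.
have v1g : v1 `|` g = \top.
  by apply: t_top; rewrite -(join_tri u1) -gE; apply: tU.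
(* It suffices to compare [v1] and [u1] below [g], hence below [g `|` b]. *)
have u1v1_of_u2 : u2 <= v2 -> u1 <= v1.
  move=> u2v2; apply: (@le_cut _ _ g); first by rewrite v1g lex1.
  apply: le_trans (_ : u2 <= _); first by rewrite u2E; lattice.
  by apply: le_trans u2v2 _; rewrite v2E leIl.
have tqp : t (q, p).
  rewrite pE -[X in t (X, _)](@meet_l _ _ q (nab (u `&` b))).
    by apply: tI => //; apply/t_nab/t_sym.
  by rewrite qE; apply: nab_antitone; rewrite leIr.
have qpo : q <= p `|` o by rewrite pE joinIl lexI leUl /= qE.
(* The join of [g] with anything related to [u1] is the top element; here this
   is used for [u1] with [q] shrunk to [p], whose meet with [q] is below [p]. *)
have qpg : q <= p `|` g.
  apply: (@le_cut _ _ (b `|` (u `&` o) `|` (p `&` o))).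
    suff -> : p `|` g `|` (b `|` u `&` o `|` p `&` o) = \top by rewrite lex1.
    apply/le_anti; rewrite lex1 /=.
    have <- : b `|` (u `&` o) `|` (p `&` o) `|` g = \top.
      apply: t_top; rewrite -(join_tri u1) -gE {1}u1E; apply: tU => //.
      by apply: tU => //; apply: tI => //; apply: t_sym.
    by lattice.
  rewrite !meetUr [q `&` b]meetC bq0 join0x meetA [q `&` u]meetC uq0 meet0x.
  by rewrite join0x; lattice.
have tri_v1b : tri v1 `&` b <= g.
  have le_x : tri v1 <= g `|` tri x.
    by rewrite gE -triI; apply: tri_antitone; rewrite u1E v1E; lattice.
  have og : tri o <= g.
    by rewrite gE; apply: tri_antitone; rewrite u1E !leUx bo !leIr.
  apply: le_trans (_ : (g `|` tri x) `&` b <= _); first by apply: leI2.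
  by rewrite meetUl leUx leIl /= (le_trans xb).
have tri_v2 : tri v2 = tri u2.
  rewrite v2E u2E !triI; apply/le_anti; rewrite !leUx !leUr !andbT.
  apply/andP; split.
    apply: (@le_cut _ _ (g `|` b)).
      by rewrite -joinA [_ `|` (g `|` b)]joinC join_tri joinx1 lex1.
    rewrite -gE meetUr leUx; apply/andP; split; first by lattice.
    by rewrite (le_trans tri_v1b) ?leUl.
  by apply: lexUl; apply: tri_antitone; rewrite u1E'; lattice.
have nab_v2 : nab v2 = nab u2.
  apply/le_anti/andP; split; last first.
    by apply: nab_antitone; rewrite v2E u2E u1E'; lattice.
  have nv2 : nab v2 <= nab u.
    have nq : nab v2 <= q.
      by rewrite qE; apply: nab_antitone; rewrite v2E v1E; lattice.
    have nqog : nab v2 <= nab (q `&` o `&` g).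
      by apply: nab_antitone; rewrite v2E v1E; lattice.
    apply: (@le_cut _ _ (q `&` o `&` g)).
      apply: le_trans nq _.
      apply: le_trans (_ : p `|` (q `&` o `&` g) <= _).
        by rewrite !joinIr !lexI qpo qpg leUr.
      by rewrite pE; apply: leU2; rewrite ?leIr.
    apply: le_trans (_ : nab (q `&` o `&` g) `&` (q `&` o `&` g) <= _).
      by apply: leI2.
    by rewrite meetC meet_nab le0x.
  rewrite (_ : u2 = v2 `|` (u2 `&` u)).
    rewrite nabU lexI lexx /=; apply: le_trans nv2 _.
    by apply: nab_antitone; rewrite leIr.
  apply/le_anti/andP; split.
    by rewrite v2E u2E u1E'; lattice.
  by rewrite v2E u2E u1E'; lattice.
apply: le_trans (_ : u `&` o `&` v1 <= _).
  rewrite lexI lexx /=; apply: le_trans (_ : u1 <= _).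
    by rewrite u1E'; lattice.
  by apply: u1v1_of_u2; rewrite (Phi_trivial _ _ nab_v2 tri_v2).
rewrite v1E meetUr leUx; apply/andP; split; first by lattice.
by rewrite meetACA uq0 meet0x le0x.
Qed.

(** The failure of this inequality is measured by an element [v] disjoint from
    [u] and related to an element below [nab u]. The last of three exchanges
    puts [u] below a join whose terms are disjoint from [u] or, once cut by [u],
    below [nab (nab a)]. *)
Lemma nab_le_related a u : a <= u -> t (a, u) -> nab a <= nab u.
Proof.
move=> au tau.
(* The names [o], [x], [b], [v] are those of the first exchange. The element
   [v] is the defect to be removed: [nab a = nab u `|` v] with [v] disjoint from
   [u]. The element [b] lies below [x] and contains the element [c] related
   to [v]; its part below [u] is large enough to make [V = nab b] disjoint
   from [u]. *)
have [N NE] : {N | N = nab a} by eexists.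
have [n nE] : {n | n = nab u} by eexists.
have [o oE] : {o | o = N `|` u} by eexists.
have [x xE] : {x | x = n `|` u} by eexists.
have [e eE] : {e | e = nab (u `&` tri o)} by eexists.
have [c cE] : {c | c = n `&` tri o} by eexists.
have [b bE] : {b | b = c `|` (u `&` tri o `|` u `&` e)} by eexists.
have [V VE] : {V | V = nab b} by eexists.
have [v vE] : {v | v = N `&` tri x} by eexists.
have nN : n <= N by rewrite nE NE nab_antitone.
have tNn : t (N, n) by rewrite NE nE; apply: t_nab.
have tox : t (o, x) by rewrite oE xE; apply: tU.
have tvc : t (v, c) by rewrite vE cE; apply/tI/t_tri/t_sym.
have uN0 : u `&` N = \bot.
  apply: related_bot; rewrite -(meet_nab a) -NE.
  by apply: tI => //; apply: t_sym.
have vN : v <= N by rewrite vE leIl.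
have uv0 : u `&` v = \bot.
  by apply/eqP; rewrite -lex0 -uN0 leI2.
have uex0 : u `&` e `&` tri x = \bot.
  apply: related_bot; suff <- : u `&` e `&` tri o = \bot.
    by apply: tI => //; apply/t_tri/t_sym.
  by rewrite meetAC eE meet_nab.
have Vv0 : V `&` v = \bot.
  apply: related_bot; suff <- : V `&` c = \bot by apply: tI.
  apply/eqP; rewrite -lex0 -(meet_nab b) -VE lexI leIl andbT.
  by rewrite bE; lattice.
have uV0 : u `&` V = \bot.
  have ueb : u `&` V <= b.
    rewrite bE; apply: lexUr; apply: lexUr; rewrite lexI leIl /=.
    apply: leIxr; rewrite VE eE; apply: nab_antitone.
    by rewrite bE; lattice.
  by apply/eqP; rewrite -lex0 -(meet_nab b) -VE lexI ueb leIr.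
have N_le : N <= n `|` v.
  apply: (@le_trans _ _ ((N `&` x) `|` (N `&` tri x))).
    by rewrite -meetUr join_tri meetx1.
  rewrite -vE xE; apply: leU2 => //.
  by rewrite meetUr [N `&` u]meetC uN0 joinx0 leIr.
(* First exchange: [nab a] and [nab u] agree below [nab V]. *)
have NVn : N `&` nab V <= n.
  suff vVn : nab V `&` v <= n.
    apply: le_trans (leI2 N_le (lexx _)) _; rewrite meetUl leUx leIl /=.
    by rewrite meetC.
  have xVv : nab V `&` v <= x.
    apply: le_trans (_ : (nab V `&` v) `&` o <= _).
      by rewrite lexI lexx /= oE; apply: lexUl; apply: leIxr.
    apply: le_trans (_ : b `|` x <= _); last first.
      by rewrite leUx lexx andbT bE cE xE; lattice.
    apply: related_exchange.
    - rewrite bE oE !leUx; apply/and3P; split.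
      + by rewrite cE; apply: lexUl; apply: leIxl.
      + by lattice.
      + by lattice.
    - apply: (@t_trans (nab V `&` c)); first exact: tI.
      rewrite -[X in t (X, _)](@meet_l _ _ _ b); last first.
        by rewrite bE; lattice.
      by apply: tI => //; apply: tI => //; apply: t_sym.
    - rewrite -VE; apply: lexUl; apply: le_trans (le_nab_nab V) _.
      by apply: nab_antitone; rewrite leIl.
    - rewrite {1}bE !meetUr !leUx; apply/and3P; split.
      + by rewrite cE; lattice.
      + by lattice.
      + by rewrite meetC uex0 le0x.
  apply: (@le_cut_bot _ _ u); first by rewrite -xE.
  by apply/eqP; rewrite -lex0 -uv0 meetC leI2 // leIr.
have [W WE] : {W | W = V `|` u} by eexists.
have [w wE] : {w | w = v `|` nab v `|` V `|` a} by eexists.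
have Wv0 : W `&` v = \bot by rewrite WE meetUl Vv0 uv0 joinx0.
(* Second exchange: [W] is replaced by [w], which contains [a] where [W]
   contains the larger element [u], without increasing [tri]. *)
have tri_wW : tri w <= tri W.
  have [o2 o2E] : {o2 | o2 = v `|` nab v `|` V `|` u} by eexists.
  have [b2 b2E] : {b2 | b2 = v `|` (W `&` tri W `&` tri o2)} by eexists.
  have two : t (tri w, tri o2) by apply: t_tri; rewrite wE o2E; apply: tU.
  have Wo2 : W <= o2 by rewrite WE o2E -!joinA; do 2!apply: lexUr.
  have o2W : tri o2 <= tri W by apply: tri_antitone.
  have ex : (W `&` tri w) `&` o2 <= b2 `|` tri W.
    apply: related_exchange.
    - by rewrite b2E leUx o2E -!joinA leUl /= !joinA -o2E -meetA leIxl.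
    - apply: (@t_trans (W `&` tri o2)); first exact: tI.
      rewrite -[X in t (X, _)](@meet_l _ _ _ b2); last first.
        by rewrite b2E; apply: lexUr; rewrite !lexI leIl leIr /= leIxr.
      by apply: tI => //; apply: tI => //; apply: t_sym.
    - apply: lexUr; apply: (@le_trans _ _ (nab v)).
        by apply: nab_antitone; rewrite b2E leUl.
      by rewrite o2E; lattice.
    - rewrite {1}b2E meetUr leUx; apply/andP; split; last by lattice.
      by rewrite (le_trans (leI2 (tri_tri_le W) (lexx v))) // Wv0 le0x.
  apply: (@le_cut _ _ W); first by rewrite joinC join_tri lex1.
  apply: (@le_cut_bot _ _ v); last first.
    by apply/eqP; rewrite -lex0 -Wv0; lattice.
  rewrite meetC; apply: le_trans (_ : (W `&` tri w) `&` o2 <= _).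
    by rewrite lexI lexx /= leIxl.
  by apply: le_trans ex _; rewrite b2E; lattice.
(* Third exchange: the bound on [tri w] is its fourth hypothesis. *)
have uw : u <= w.
  apply: le_trans (_ : u `&` W <= _); first by rewrite WE; lattice.
  apply: le_trans (_ : (V `|` a) `|` w <= _).
    apply: related_exchange.
    - by rewrite WE leU2.
    - rewrite -[X in t (X, _)](@meet_l _ _ _ (V `|` u)); last by rewrite leUr.
      by apply: tI => //; apply: tU => //; apply: t_sym.
    - by rewrite nabU -NE -nE meetC lexUl.
    - by rewrite leIxl.
  by rewrite wE; lattice.
(* [u] is disjoint from the terms [v] and [V] of [w]; the other two terms,
   cut by [u], are below [nab (nab a)]. *)
have uNN : u <= nab N.
  apply: le_trans (_ : u `&` w <= _); first by rewrite lexI lexx.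
  rewrite wE !meetUr uv0 uV0 joinx0 join0x leUx; apply/andP; split; last first.
    by rewrite NE leIxr // le_nab_nab.
  apply: (@le_trans _ _ (nab (n `|` v))); last exact: nab_antitone.
  by rewrite nabU nE; apply: leI2 => //; apply: le_nab_nab.
by rewrite -NE -nE nE; apply: le_trans (le_nab_nab N) (nab_antitone _ _ uNN).
Qed.

(** By [nab_le_related], comparable related elements with the same [tri] are
    equal. The meets of [a0 <= u0] with [tri u0] both have [tri] equal to the
    top element, and nothing is lost by taking them, since [a0 `|` tri u0],
    being related to [u0 `|` tri u0], is the top element. *)
Lemma separated_congr_trivial x y : t (x, y) -> x = y.
Proof.
suff le_of a0 u0 : a0 <= u0 -> t (a0, u0) -> u0 <= a0.
  move=> txy; apply/le_anti/andP; split.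
    apply: le_trans (_ : x `&` y <= _); last by rewrite leIr.
    apply: le_of; first by rewrite leIl.
    by rewrite -[X in t (_, X)]meetxx; apply: tI => //; apply: t_sym.
  apply: le_trans (_ : x `&` y <= _); last by rewrite leIl.
  apply: le_of; first by rewrite leIr.
  by rewrite -[X in t (_, X)]meetxx; apply: tI.
move=> a0u0 t0.
have a0u1 : a0 `|` tri u0 = \top.
  by apply: t_top; rewrite -(join_tri u0); apply: tU.
have au : a0 `&` tri u0 = u0 `&` tri u0.
  have le_au : a0 `&` tri u0 <= u0 `&` tri u0 by apply: leI2.
  have tri_u : tri (u0 `&` tri u0) = \top.
    by apply/eqP; rewrite triI join_tri.
  apply: Phi_trivial.
    apply/le_anti; rewrite (nab_antitone _ _ le_au) andbT.
    by apply: nab_le_related => //; apply: tI.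
  by apply/le_anti; rewrite tri_u lex1 -{1}tri_u tri_antitone.
apply: (@le_cut _ _ (tri u0)); first by rewrite a0u1 lex1.
by rewrite -au leIl.
Qed.

End SeparatedCongruence.

(** * The correspondence between normal filters and congruences *)

Section FiltersAndCongruences.
Context {d : Order.disp_t} {L : distrWdlType d}.
Local Open Scope order_scope.
Implicit Types (F G : set L) (t : set (L * L)) (f x y : L).

Definition filter_congr F : set (L * L) :=
  [set p | exists2 f, F f & p.1 `&` f = p.2 `&` f].

Definition top_class t : set L := [set x | t (x, \top)].

(** [f] and [tri f] cover [x], so [nab x] is the meet of [nab (x `&` f)] and
    [nab (x `&` tri f)]. *)
Lemma nab_meet f x : nab (x `&` f) `&` nab (tri f) <= nab x.
Proof.
rewrite -nabU; apply: nab_antitone.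
by rewrite -[leLHS](meet_join_tri x f) leU2 ?leIr.
Qed.

Lemma tri_meet f x : tri (x `&` f) `&` nab (tri f) <= tri x.
Proof. by rewrite triI meetUl meet_nab joinx0 leIl. Qed.

(** Compatibility with [tri] and [nab] is where normality enters: if [f]
    witnesses that [x] and [y] are identified, then [nab (tri f)] witnesses it
    for their images, by [tri_meet] and [nab_meet]. *)
Lemma filter_congrP {F} : is_normal_filter F -> is_congruence (filter_congr F).
Proof.
move=> [[[f0 Ff0] F_up FI] F_nab].
have subst_le h x y f : (forall u, h (u `&` f) `&` nab (tri f) <= h u) ->
    (forall u v, u <= v -> h v <= h u) -> x `&` f = y `&` f ->
    h x `&` nab (tri f) <= h y `&` nab (tri f).
  move=> hI h_anti xy; rewrite lexI leIr andbT.
  by apply: le_trans (hI y); rewrite -xy leI2 // h_anti // leIl.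
have compat h x y : (forall f u, h (u `&` f) `&` nab (tri f) <= h u) ->
    (forall u v, u <= v -> h v <= h u) -> filter_congr F (x, y) ->
    filter_congr F (h x, h y).
  move=> hI h_anti [f Ff /= xy]; exists (nab (tri f)); first exact: F_nab.
  by apply/le_anti; rewrite /= !(subst_le h _ _ f).
split; split.
- by move=> x; exists f0.
- by move=> x y [f Ff /= xy]; exists f.
- move=> x y z [f Ff /= xy] [g Fg /= yz]; exists (f `&` g); first exact: FI.
  by rewrite /= meetA xy -!meetA [f `&` g]meetC !meetA yz.
- move=> x x' y y' [f Ff /= xx'] [g Fg /= yy'].
  by exists (f `&` g); [exact: FI | rewrite /= meetACA xx' yy' meetACA].
- move=> x x' y y' [f Ff /= xx'] [g Fg /= yy'].
  exists (f `&` g); [exact: FI | rewrite /= !meetUl].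
  by rewrite !meetA xx' -!meetA [f `&` g]meetC !meetA yy'.
- by move=> x y; apply: compat; [exact: tri_meet | exact: tri_antitone].
- by move=> x y; apply: compat; [exact: nab_meet | exact: nab_antitone].
Qed.

Lemma top_class_normal {t} : is_congruence t -> is_normal_filter (top_class t).
Proof.
move=> [[t_refl t_sym t_trans] [tI tU t_tri t_nab]]; split.
  split.
  - by exists \top; apply: t_refl.
  - move=> x y /= tx xy.
    rewrite /top_class /= -(joinx1 y) -[X in t (X, _)](join_l xy).
    by apply: tU.
  - by move=> x y tx ty; rewrite /top_class /= -(meetxx \top); apply: tI.
move=> x tx; rewrite /top_class /= -[X in t (_, X)](nab0) -tri1.
by apply/t_nab/t_tri.
Qed.

Lemma top_class_filter_congr {F} :
  is_normal_filter F -> top_class (filter_congr F) = F.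
Proof.
move=> [[_ F_up FI] _]; apply/seteqP; split => x.
  by move=> [f Ff /= xf]; apply: F_up Ff _; rewrite -(meet1x f) -xf leIl.
by move=> Fx; exists x => //=; rewrite meetxx meet1x.
Qed.

Lemma filter_congr_top_class {t} :
  is_congruence t -> filter_congr (top_class t) `<=` t.
Proof.
move=> [[t_refl t_sym t_trans] [tI _ _ _]] [x y] [f tf /= xy].
apply: (t_trans _ (x `&` f)).
  by rewrite -[X in t (X, _)]meetx1; apply: tI => //; apply: t_sym.
by rewrite xy -[X in t (_, X)]meetx1; apply: tI.
Qed.

Lemma filter_congr_mono {F G} : F `<=` G -> filter_congr F `<=` filter_congr G.
Proof. by move=> FG [x y] [f Ff xy]; exists f => //; apply: FG. Qed.

Lemma top_class_mono {t t'} : t `<=` t' -> top_class t `<=` top_class t'.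
Proof. by move=> tt' x; apply: tt'. Qed.

Lemma top_class_Delta : top_class (Delta L) = [set \top].
Proof. by []. Qed.

Lemma filter_congrT : filter_congr setT = setT.
Proof.
by apply/seteqP; split=> // -[x y] _; exists \bot => //=; rewrite !meetx0.
Qed.

Lemma Delta_congr : is_congruence (Delta L).
Proof. by split; split; rewrite /Delta /= => // > -> // ->. Qed.

Lemma setT_congr : is_congruence [set: L * L].
Proof. by []. Qed.

Lemma normal_filter1 : is_normal_filter [set (\top : L)].
Proof. rewrite -top_class_Delta; exact: top_class_normal Delta_congr. Qed.

Lemma normal_filterT : is_normal_filter [set: L].
Proof. exact: top_class_normal setT_congr. Qed.

Lemma normal_filter_neq1 {F} : is_normal_filter F ->
  F <> [set \top] -> filter_congr F <> Delta L.
Proof. by move=> nF + FD; rewrite -(top_class_filter_congr nF) FD. Qed.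

Lemma top_class_neq1 {t} : Phi L = Delta L -> is_congruence t ->
  t <> Delta L -> top_class t <> [set \top].
Proof.
move=> hPhi ct + t1; apply; apply/seteqP; split=> -[x y].
  apply: (separated_congr_trivial t ct) => {x y} [x tx | x y xnab xtri].
    by have : top_class t x by []; rewrite t1.
  by have : Phi L (x, y) by []; rewrite hPhi.
by rewrite /Delta /= => ->; case: ct => [[]].
Qed.

End FiltersAndCongruences.

(** * Subdirect irreducibility and simplicity *)

Lemma card_eq2_pair {T : Type} (A : set T) x y :
  x <> y -> A x -> A y -> A #= `I_2 <-> A = [set x; y].
Proof.
move=> xy Ax Ay; split=> [/card_set_bijP[f [f_fun f_inj _]] | ->].
  have {}f_inj u v : A u -> A v -> f u = f v -> u = v.
    by move=> Au Av; apply: f_inj; rewrite inE.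
  apply/seteqP; split=> [z Az | z [] -> //] /=.
  have fxy : f x <> f y by move=> /f_inj-/(_ Ax Ay).
  have [fzx | fzx] := eqVneq (f z) (f x); first by left; apply: f_inj.
  right; apply: f_inj => //.
  move: (f_fun x Ax) (f_fun y Ay) (f_fun z Az) fxy fzx => /=.
  by case: (f x) (f y) (f z) => [|[|?]] [|[|?]] [|[|?]].
pose g i := if i is 0 then x else y.
rewrite (_ : [set x; y] = g @` `I_2).
  by apply: inj_card_eq => -[|[|i]] [|[|j]] //; rewrite !inE //= => _ _ E;
    case: xy.
apply/seteqP; split=> [z [] -> | z [[|i] _ <-]].
- by exists 0.
- by exists 1.
- by left.
- by right.
Qed.

Theorem theorem22 (d : Order.disp_t) (L : distrWdlType d)
    (hL : exists x y : L, x <> y)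
    (hPhi : Phi L = Delta L) :
  (subdirectly_irreducible L <->
     has_unique_atom (NF L) [set (\top : L)%O]) /\
  (simple L <-> NF L #= `I_2).
Proof.
have one_neqT : [set (\top : L)%O] <> [set: L].
  move=> E; case: hL => x [y]; apply.
  have all_top (z : L) : z = \top%O by have : [set: L] z by []; rewrite -E.
  by rewrite (all_top x) (all_top y).
have card2 : NF L #= `I_2 <-> NF L = [set [set \top%O]; [set: L]].
  apply: card_eq2_pair one_neqT _ _; first exact: normal_filter1.
  exact: normal_filterT.
split; split.
- move=> [mu [[cmu mu_neq] mu_least]]; exists (top_class mu).
  have nA := top_class_normal cmu.
  have A_neq := top_class_neq1 hPhi cmu mu_neq.
  have A_least B : NF L B -> B <> [set \top%O] -> top_class mu `<=` B.
    move=> nB B_neq; rewrite -(top_class_filter_congr nB).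
    apply: top_class_mono; apply: mu_least.
    exact: conj (filter_congrP nB) (normal_filter_neq1 nB B_neq).
  split=> //; split.
    split=> // B nB BA; have [->|B_neq] := pselect (B = [set \top%O]).
      by left.
    by right; apply/seteqP; split=> //; exact: A_least.
  by move=> B [nB B_neq B_min]; case: (B_min _ nA (A_least _ nB B_neq)).
- move=> [A [[[nA A_neq _] _] A_least]]; exists (filter_congr A); split.
    exact: conj (filter_congrP nA) (normal_filter_neq1 nA A_neq).
  move=> t [ct t_neq]; apply: subset_trans (filter_congr_top_class ct).
  apply: filter_congr_mono; apply: A_least; first exact: top_class_normal.
  exact: top_class_neq1.
- move=> sL; apply/card2/seteqP; split=> F /=; last first.
    by case=> ->; [exact: normal_filter1 | exact: normal_filterT].
  move=> nF; have : Con L (filter_congr F) by apply: filter_congrP.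
  by rewrite sL => -[E | E]; [left | right];
    rewrite -(top_class_filter_congr nF) E.
- move=> /card2 NFE; apply/seteqP; split=> t /=; last first.
    by case=> ->; [exact: Delta_congr | exact: setT_congr].
  move=> ct; have [->|t_neq] := pselect (t = Delta L); first by left.
  right; apply/seteqP; split=> //; rewrite -filter_congrT.
  have : NF L (top_class t) by apply: top_class_normal.
  rewrite NFE => -[/(top_class_neq1 hPhi ct t_neq) //|<-].
  exact: filter_congr_top_class.
Qed.
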